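(* Let $R$ be a Noetherian commutative ring. If $R$ is a non-local integral domain, then $R$ is half-slender.
   Context: Rings are unital and non-zero. $R^{\omega}$ is the direct product of countably many copies of $R$, and $R^{[\omega]}\subseteq R^{\omega}$ is the direct sum (sequences of finite support). $R$ is half-slender if $\mathrm{Hom}_R(R^{\omega}/R^{[\omega]},R)=0$; equivalently, every $R$-linear map $F:R^{\omega}\to R$ that vanishes on all the standard unit vectors $e_i$ ($i\in\omega$) is zero. *)

(* Defs.v *)
From HB Require Import structures.
From mathcomp Require Import all_boot all_order all_algebra.
From mathcomp Require Import generic_quotient.
From mathcomp Require Import all_classical.

Set Implicit Arguments.
Unset Strict Implicit.
Unset Printing Implicit Defensive.

Import GRing.Theory.
Local Open Scope classical_set_scope.
Local Open Scope ring_scope.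
Local Open Scope quotient_scope.

(* MathComp's quotient by an additive subgroup is only a Z-module; when the
   subgroup is a submodule it carries the induced scalar multiplication. *)
Section QuotientLmodule.
Variables (R : pzRingType) (V : lmodType R).
Variables (S : {pred V}) (submodS : submod_closed S).

Definition submodule of submod_closed S : {pred V} := S.
Notation W := (submodule submodS).

HB.instance Definition _ :=
  GRing.isSubmodClosed.Build R V W (GRing.submod_closed_semi submodS).

Definition quot_lmod : Type := Quotient.quot W.

HB.instance Definition _ := GRing.Zmodule.on quot_lmod.

Definition quot_pi (x : V) : quot_lmod := \pi_(Quotient.quot W) x.
Definition quot_repr (q : quot_lmod) : V := repr (q : Quotient.quot W).

Lemma quot_reprK : cancel quot_repr quot_pi.
Proof. by move=> q; rewrite /quot_pi /quot_repr reprK. Qed.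

Lemma quot_piP (x y : V) : quot_pi x = quot_pi y <-> x - y \in S.
Proof.
have -> : (x - y \in S) = (x - y \in W) by [].
by rewrite Quotient.idealrBE; split=> [|/eqP] // E; apply/eqP.
Qed.

Lemma quot_piD : {morph quot_pi : x y / x + y}.
Proof. by move=> x y; rewrite /quot_pi Quotient.pi_add. Qed.

Definition quot_scale (a : R) (q : quot_lmod) : quot_lmod :=
  quot_pi (a *: quot_repr q).

Lemma quot_scale_pi (a : R) (x : V) :
  quot_scale a (quot_pi x) = quot_pi (a *: x).
Proof.
apply/quot_piP; rewrite -scalerBr -[a *: _]addr0.
by apply: submodS.2; [apply/quot_piP; rewrite quot_reprK | exact: submodS.1].
Qed.

Lemma quot_scaleA a b q : quot_scale a (quot_scale b q) = quot_scale (a * b) q.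
Proof. by rewrite -[q]quot_reprK !quot_scale_pi scalerA. Qed.

Lemma quot_scale1 : left_id 1 quot_scale.
Proof. by move=> q; rewrite -[q]quot_reprK quot_scale_pi scale1r. Qed.

Lemma quot_scaleDr : right_distributive quot_scale +%R.
Proof.
move=> a p q; rewrite -[p]quot_reprK -[q]quot_reprK -quot_piD.
by rewrite !quot_scale_pi scalerDr quot_piD.
Qed.

Lemma quot_scaleDl q : {morph quot_scale^~ q : a b / a + b}.
Proof.
by move=> a b; rewrite -[q]quot_reprK !quot_scale_pi scalerDl quot_piD.
Qed.

HB.instance Definition _ := GRing.Zmodule_isLmodule.Build R quot_lmod
  quot_scaleA quot_scale1 quot_scaleDr quot_scaleDl.

Lemma quot_pi_linear : linear quot_pi.
Proof. by move=> a x y; rewrite quot_piD -quot_scale_pi. Qed.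

HB.instance Definition _ :=
  GRing.isLinear.Build R V quot_lmod _ quot_pi quot_pi_linear.

End QuotientLmodule.

Section HalfSlender.
Variable R : comNzRingType.

(* R^o is R regarded as a module over itself; sequences form an R-module
   under the pointwise operations. *)
Definition sequences : Type := nat -> R^o.
HB.instance Definition _ := GRing.Lmodule.on sequences.

Definition finitely_supported : {pred sequences} :=
  [pred x : sequences | `[< finite_set [set i | x i != 0] >]].

Lemma finitely_supported_submod : submod_closed finitely_supported.
Proof.
split; first by apply/asboolP; rewrite (_ : [set _ | _] = set0) //;
  apply/seteqP; split=> i //=; rewrite eqxx.
move=> a x y /asboolP fx /asboolP fy; apply/asboolP.
have : finite_set ([set i | x i != 0] `|` [set i | y i != 0]).
  by rewrite finite_setU.
apply: sub_finite_set => i /=.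
have -> : (a *: x + y) i = a *: x i + y i by [].
case: (eqVneq (x i) 0) => [->|]; last by left.
by rewrite scaler0 add0r; right.
Qed.

Definition half_slender : Prop :=
  forall F : {linear quot_lmod finitely_supported_submod -> R^o}, forall q, F q = 0.

End HalfSlender.
Arguments finitely_supported R : clear implicits.

Section Ideals.
Variable R : comNzRingType.

Definition ideal (I : set R) : Prop :=
  [/\ I 0, forall x y, I x -> I y -> I (x + y) & forall a x, I x -> I (a * x)].

Definition finitely_generated_ideal (I : set R) : Prop :=
  exists (n : nat) (g : 'I_n -> R),
    I = [set x | exists c : 'I_n -> R, x = \sum_(i < n) c i * g i].

Definition noetherian : Prop :=
  forall I : set R, ideal I -> finitely_generated_ideal I.

Definition maximal_ideal (M : set R) : Prop :=
  [/\ ideal M, M <> setT &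
      forall J : set R, ideal J -> M `<=` J -> J = M \/ J = setT].

Definition is_local : Prop := exists! M : set R, maximal_ideal M.

End Ideals.
Arguments half_slender R : clear implicits.
Arguments noetherian R : clear implicits.
Arguments is_local R : clear implicits.

(* Main.v *)
Require Import Defs.
From mathcomp Require Import all_boot all_algebra.
From mathcomp Require Import all_classical.
From mathcomp Require Import ring.

(** Since R is not local, there are non-units a, b with a + b = 1.  Let F vanish
    on the finitely supported sequences.  A sequence (a^n y_n)_n is, for every
    k, a multiple of a^k up to a finitely supported sequence, so its value
    under F lies in the intersection of the ideals (a^k), which is zero by
    Krull's intersection theorem; likewise for b.  As a^n and b^n are comaximal
    for each n, every sequence is a sum (a^n y_n)_n + (b^n z_n)_n, hence F = 0. *)

Set Implicit Arguments.
Unset Strict Implicit.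
Unset Printing Implicit Defensive.

Import GRing.Theory.
Local Open Scope classical_set_scope.
Local Open Scope ring_scope.

(* A [comNzRingType] carries no [GRing.unit] predicate. *)
Definition invertible (R : comNzRingType) (x : R) : Prop := exists y, y * x = 1.

Lemma proper_ideal_noninvertible (R : comNzRingType) (I : set R) (x : R) :
  ideal I -> I <> setT -> I x -> ~ invertible x.
Proof.
move=> [_ _ IM] IT Ix [y yx]; apply: IT; apply/seteqP; split=> // z _.
by rewrite -[z]mulr1 -yx mulrA; apply: IM.
Qed.

(** Without such a pair the non-invertible elements are closed under addition, so they form an
    ideal; it contains every proper ideal and is thus the only maximal one. *)
Lemma nonlocal_comaximal (R : comNzRingType) :
  ~ is_local R ->
  exists a b : R, [/\ a + b = 1, ~ invertible a & ~ invertible b].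
Proof.
move=> nloc; apply: contrapT => nab; apply: nloc.
pose M : set R := [set x | ~ invertible x].
have idM : ideal M.
  split=> /=.
  - by case=> y /eqP; rewrite mulr0 eq_sym oner_eq0.
  (* Scaling by the inverse [v] of [x + y] yields two non-invertible elements with sum 1. *)
  - move=> x y Mx My [v vxy]; apply: nab; exists (v * x), (v * y).
    split; first by rewrite -mulrDr.
    + by case=> w wE; apply: Mx; exists (w * v); rewrite -mulrA.
    + by case=> w wE; apply: My; exists (w * v); rewrite -mulrA.
  - by move=> a x Mx [y yE]; apply: Mx; exists (y * a); rewrite -mulrA.
have MT : M <> setT.
  move=> MT; have : M 1 by rewrite MT.
  by apply; exists 1; rewrite mulr1.
exists M; split.
  split=> // J idJ MJ; have [->|JT] := pselect (J = setT); first by right.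
  left; apply/seteqP; split=> // x; exact: proper_ideal_noninvertible.
move=> M' [idM' M'T maxM'].
have [//|//|//] := maxM' M idM _.
by move=> x; apply: proper_ideal_noninvertible.
Qed.

(** The ascending colon ideals [(d : a ^+ n)], with union [I], stabilise at some exponent [m].
    Writing [d = a ^+ m.+1 * c] puts [c] in [I], so [a ^+ m * c = e * d] and [d = a * e * d]; here
    [1 - e * a] is nonzero since [a] is not invertible. *)
Lemma krull_intersection (R : comNzRingType) (a d : R) :
  noetherian R -> GRing.integral_domain_axiom R -> ~ invertible a ->
  (forall n, exists c, d = a ^+ n * c) -> d = 0.
Proof.
move=> noeR domR na dvd.
pose I : set R := [set x | exists n e, a ^+ n * x = e * d].
have liftI x n m e : (n <= m)%N -> a ^+ n * x = e * d ->
    exists f, a ^+ m * x = f * d.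
  by move=> nm xE; exists (a ^+ (m - n) * e); rewrite -mulrA -xE mulrA -exprD subnK.
have idI : ideal I.
  split.
  - by exists 0%N, 0; rewrite mulr0 mul0r.
  - move=> x y [n [e xE]] [m [f yE]].
    have [e' xE'] := liftI _ _ _ _ (leq_maxl n m) xE.
    have [f' yE'] := liftI _ _ _ _ (leq_maxr n m) yE.
    by exists (maxn n m), (e' + f'); rewrite mulrDr xE' yE' mulrDl.
  - by move=> b x [n [e xE]]; exists n, (b * e); rewrite mulrCA xE mulrA.
have [k [g IE]] := noeR I idI.
have Ig i : I (g i).
  rewrite IE; exists (fun j => (j == i)%:R).
  rewrite (bigD1 i) //= eqxx mul1r big1 ?addr0 // => j /negbTE ->.
  by rewrite mul0r.
have [N NP] := choice Ig.
(* The largest exponent needed by a generator serves all of [I]. *)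
pose m := \max_(i < k) N i.
have Im x : I x -> exists e, a ^+ m * x = e * d.
  rewrite IE => -[c ->].
  have /choice[h hE] i : exists f, a ^+ m * g i = f * d.
    have [e gE] := NP i; apply: liftI gE; exact: leq_bigmax.
  exists (\sum_(i < k) c i * h i); rewrite mulr_sumr mulr_suml.
  by apply: eq_bigr => i _; rewrite mulrCA hE mulrA.
have [c dE] := dvd m.+1.
have [|e cE] := Im c; first by exists m.+1, 1; rewrite mul1r.
have /domR/orP[/eqP//|] : d * (1 - e * a) = 0.
  by rewrite mulrBr mulr1 {1}dE exprS -mulrA cE; ring.
by rewrite subr_eq0 => /eqP ea; case: na; exists e.
Qed.

(** Multiply the two identities: every term of the product except [v * y * (v' * z)] has the factor
    [x]. *)
Lemma comaximalM (R : comNzRingType) (x y z : R) :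
  (exists u v, u * x + v * y = 1) -> (exists u v, u * x + v * z = 1) ->
  exists u v, u * x + v * (y * z) = 1.
Proof.
move=> [u [v xy]] [u' [v' xz]].
exists (u * (u' * x + v' * z) + v * y * u'), (v * v').
transitivity ((u * x + v * y) * (u' * x + v' * z)); first by ring.
by rewrite xy xz mulr1.
Qed.

Lemma comaximalX (R : comNzRingType) (x y : R) (n : nat) :
  (exists u v, u * x + v * y = 1) -> exists u v, u * x + v * y ^+ n = 1.
Proof.
move=> xy; elim: n => [|n IHn]; last by rewrite exprS; apply: comaximalM.
by exists 0, 1; rewrite mul0r add0r mulr1.
Qed.

Lemma comaximalXX (R : comNzRingType) (x y : R) (n : nat) :
  x + y = 1 -> exists u v, u * x ^+ n + v * y ^+ n = 1.
Proof.
move=> xy; apply: comaximalX.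
have [|u [v uv]] := @comaximalX R y x n; first by exists 1, 1; rewrite !mul1r addrC.
by exists v, u; rewrite addrC.
Qed.

Lemma linear_powers_eq0 (R : comNzRingType) (a : R)
    (G : {linear sequences R -> R^o}) (y : sequences R) :
  noetherian R -> GRing.integral_domain_axiom R -> ~ invertible a ->
  (forall x, x \in finitely_supported R -> G x = 0) ->
  G (fun n => a ^+ n * y n) = 0.
Proof.
move=> noeR domR na G0; apply: (krull_intersection noeR domR na) => k.
(* Below index [k] the factor [a ^+ k] need not divide [a ^+ n * y n]; the 0 put there changes only
   finitely many entries. *)
pose z : sequences R := fun n => if (n < k)%N then 0 else a ^+ (n - k) * y n.
exists (G z); set x : sequences R := fun n => _.
apply/eqP; rewrite -subr_eq0; apply/eqP.
transitivity (G (x - a ^+ k *: z)); first by rewrite linearB linearZ.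
apply: G0; apply/asboolP; apply: sub_finite_set (finite_II k) => i /=.
have -> : (x - a ^+ k *: z) i = a ^+ i * y i - a ^+ k * z i by [].
rewrite /z; case: ltnP => // ki.
by rewrite mulrA -exprD subnKC // subrr eqxx.
Qed.

Theorem theorem4p42 (R : comNzRingType) :
  noetherian R -> GRing.integral_domain_axiom R -> ~ is_local R ->
  half_slender R.
Proof.
move=> noeR domR /nonlocal_comaximal[a [b [ab na nb]]] F q.
rewrite -[q]quot_reprK; move: (quot_repr q) => x {q}.
pose pi : {linear sequences R -> _} :=
  @quot_pi R (sequences R) _ (finitely_supported_submod R).
pose G : {linear sequences R -> R^o} := F \o pi.
have G0 y : y \in finitely_supported R -> G y = 0.
  move=> fy; rewrite -[RHS](linear0 F) -(linear0 pi) /=; congr (F _).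
  by apply/quot_piP; rewrite subr0.
(* The coefficients depend on [n], so they are chosen as sequences. *)
have /choice[u /choice[v uv]] n := comaximalXX n ab.
have -> : x = (fun n => a ^+ n * (u n * x n)) + (fun n => b ^+ n * (v n * x n))
    :> sequences R.
  apply/funext => n; rewrite -[LHS]mul1r -(uv n).
  transitivity (a ^+ n * (u n * x n) + b ^+ n * (v n * x n)) => //.
  by ring.
change (G ((fun n => a ^+ n * (u n * x n)) + (fun n => b ^+ n * (v n * x n))) = 0).
rewrite linearD (linear_powers_eq0 _ noeR domR na G0).
by rewrite (linear_powers_eq0 _ noeR domR nb G0) addr0.
Qed.
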